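(* Let $n\ge2$, let $\mathcal{P}$ be a probability distribution on $\mathcal{Z}=\mathcal{X}\times\mathcal{Y}$, let $h:\mathcal{Z}^{n-1}\times\mathcal{X}\to\mathcal{R}$ be a possibly stochastic prediction function, and let $\ell:\mathcal{R}\times\mathcal{Y}\to[0,1]$ be a (measurable) loss. Then \[ \mathrm{gen}(h)\le\frac{c_n}{\sqrt2}\,\mathbb{E}_{z^n\sim\mathcal{P}^n}\sqrt{\mathrm{floo\text{-}CMI}(h,z^n)},\qquad c_n=\frac{n}{n-1}. \]
   Context: $h(z,x)$ is the (possibly random) prediction on input $x$ after training on $z$; its randomness is independent of the data and of $U$ below. For a training set $z^{m}=((x_1,y_1),\dots,(x_m,y_m))$, the true loss is $\mathcal{L}(h,z^m)=\mathbb{E}_{(x',y')\sim\mathcal{P}}[\ell(h(z^m,x'),y')]$ and the empirical loss is $\widehat{\mathcal{L}}(h,z^m)=\frac1m\sum_{i=1}^m\ell(h(z^m,x_i),y_i)$. The generalization gap is $\mathrm{gen}(h)=\big|\mathbb{E}\big[\widehat{\mathcal{L}}(h,Z^{n-1})-\mathcal{L}(h,Z^{n-1})\big]\big|$ with $Z^{n-1}\sim\mathcal{P}^{n-1}$ (expectation also over the randomness of $h$). For $z^n\in\mathcal{Z}^n$ with $z_i=(x_i,y_i)$, let $x^n=(x_1,\dots,x_n)$, let $z^{n-1}_{-u}$ be $z^n$ with $z_u$ deleted, and let $h(z^{n-1}_{-u},x^n)=(h(z^{n-1}_{-u},x_1),\dots,h(z^{n-1}_{-u},x_n))$. With $U$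 uniform on $[n]$, $\mathrm{floo\text{-}CMI}(h,z^n)=I\big(h(z^{n-1}_{-U},x^n);U\mid Z^n=z^n\big)$. *)

(* Defs.v *)
From HB Require Import structures.
From mathcomp Require Import all_boot all_order all_algebra.
From mathcomp Require Import all_classical all_reals all_analysis measurable_realfun.
Set Implicit Arguments. Unset Strict Implicit. Unset Printing Implicit Defensive.
Import Order.TTheory GRing.Theory Num.Theory.
Local Open Scope classical_set_scope.
Local Open Scope ring_scope.
Local Open Scope ereal_scope.

Section kl.
Context d (T : measurableType d) (R : realType).

Definition is_density (mu nu : set T -> \bar R) (f : T -> \bar R) : Prop :=
  [/\ measurable_fun [set: T] (f : T -> \bar R), (forall x, 0 <= f x) &
      forall A, measurable A -> mu A = \int[nu]_(x in A) f x].

Definition KL (mu nu : set T -> \bar R) : \bar R :=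
  match pselect (exists f, is_density mu nu f) with
  | left H => \int[mu]_x lne (sval (cid H) x)
  | right _ => +oo
  end.
End kl.

Section iter.
Context d (T : measurableType d) (R : realType) (P : set T -> \bar R).
Fixpoint iter_exp (k : nat) : (k.-tuple T -> \bar R) -> \bar R :=
  match k return (k.-tuple T -> \bar R) -> \bar R with
  | 0%N => fun f => f [tuple]
  | k'.+1 => fun f => \int[P]_z iter_exp (fun t => f [tuple of z :: t])
  end.
End iter.

Section learning.
Context (R : realType) dX dY dR dO (X : measurableType dX) (Y : measurableType dY)
  (Rs : measurableType dR) (Om : measurableType dO).
Context (n : nat) (P : set (X * Y)%type -> \bar R) (Q : set Om -> \bar R)
  (h : Om -> (n.-1).-tuple (X * Y)%type -> X -> Rs) (ell : Rs -> Y -> R).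

Definition emp_loss (w : Om) (z : (n.-1).-tuple (X * Y)%type) : \bar R :=
  ((n.-1)%:R^-1)%:E * \sum_(i < n.-1) (ell (h w z (tnth z i).1) (tnth z i).2)%:E.

Definition true_loss (w : Om) (z : (n.-1).-tuple (X * Y)%type) : \bar R :=
  \int[P]_zz (ell (h w z zz.1) zz.2)%:E.

Definition gen : \bar R :=
  `| iter_exp P (fun z => \int[Q]_w (emp_loss w z - true_loss w z)) |.

Definition loo_set (z : n.-tuple (X * Y)%type) (u : 'I_n) : (n.-1).-tuple (X * Y)%type :=
  [tuple tnth z (lift u j) | j < n.-1].

Definition pred_vec (z : n.-tuple (X * Y)%type) (u : 'I_n) (w : Om) : n.-tuple Rs :=
  [tuple h w (loo_set z u) (tnth z i).1 | i < n].

Definition cond_law (z : n.-tuple (X * Y)%type) (u : 'I_n) : set (n.-tuple Rs) -> \bar R :=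
  pushforward Q (pred_vec z u).

Definition marg_law (z : n.-tuple (X * Y)%type) : set (n.-tuple Rs) -> \bar R :=
  fun A => (n%:R^-1)%:E * \sum_(u < n) cond_law z u A.

Definition floo_CMI (z : n.-tuple (X * Y)%type) : \bar R :=
  (n%:R^-1)%:E * \sum_(u < n) KL (cond_law z u) (marg_law z).
End learning.

(* Main.v *)
(** Write n = k + 1 and, for a fixed sample z, let l v u be the mean loss at the
    u-th point of the predictor trained without the v-th point.  Exchangeability
    of the sample makes [gen] the absolute value of the expectation over z of
    the average over u of (1/k) (sum of l u i over i <> u) - l u u, which equals
    - (n/k) times the average of l u u - (average over v of l v u).  The bracket
    is the difference of the means of one function with values in [0, 1] under
    [cond_law z u] and under [marg_law z], so Pinsker's inequality bounds twice
    its square by the KL divergence; Jensen's inequality over u concludes.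
    Pinsker's inequality itself is the integrated form of
    ln t >= 1 + a - (2/3) s^2 - (1 + a + (4/3) s^2) / t for |a| <= 2 |s|.
    The CMI need not be measurable in z, which is harmless because the integral
    of a nonnegative function is monotone without measurability. *)

Require Import Defs.
From HB Require Import structures.
From mathcomp Require Import all_boot all_order all_algebra.
From mathcomp Require Import all_classical all_reals all_analysis measurable_realfun.
From mathcomp Require Import ring lra.
Import Order.TTheory GRing.Theory Num.Theory.
Import numFieldNormedType.Exports.
Local Open Scope classical_set_scope.
Local Open Scope ring_scope.
Local Open Scope ereal_scope.
Set Implicit Arguments.
Unset Strict Implicit.
Unset Printing Implicit Defensive.

(** * Rational lower bounds for the logarithm *)

Section pinsker.
Context (R : realType).
Local Open Scope ring_scope.

(** The difference [D] of the two sides, up to its constant, has derivative (x - 1)^3 / (x (x +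
    2))^2, which has the sign of x - 1. So [D] is smallest at 1, where the two sides agree. *)
Lemma ln_ge_pade (t : R) : 0 < t ->
  5 / 2 - 4^-1 * t^-1 - 27 / 4 * (t + 2)^-1 <= ln t.
Proof.
move=> t0.
pose D (x : R) : R := ln x + 4^-1 * x^-1 + 27 / 4 * (x + 2)^-1.
have dD (x : R) : 0 < x ->
    is_derive x 1 D ((x - 1) ^+ 3 * (x ^+ 2 * (x + 2) ^+ 2)^-1).
  move=> x0; have x20 : x + 2 != 0 by rewrite gt_eqF// addr_gt0.
  have xn0 : x != 0 by rewrite gt_eqF.
  have d1 := is_derive1_ln x0.
  have d2 : is_derive x 1 (fun y : R => y^-1) (- x ^- 2 *: 1).
    by apply: (@is_deriveV _ id x 1 1) => //; exact: is_derive_id.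
  have d3 : is_derive x 1 (fun y : R => (y + 2)^-1) (- (x + 2) ^- 2 *: (1 + 0)).
    by apply: (@is_deriveV _ (fun y : R => y + 2) x (1 + 0) 1) => //.
  rewrite /D; apply: is_derive_eq.
  rewrite /GRing.scale/=; field.
  by rewrite xn0 x20.
have D1 : D 1 = 5 / 2 by rewrite /D ln1; field.
suff : D 1 <= D t by rewrite D1 /D => H; lra.
have cD (a b : R) : 0 < a -> {within `[a, b], continuous D}.
  move=> a0; apply: derivable_within_continuous => x; rewrite in_itv/= => /andP[ax _].
  by have [] := dD x (lt_le_trans a0 ax).
have q0 (x : R) : 0 <= (x ^+ 2 * (x + 2) ^+ 2)^-1.
  by rewrite invr_ge0 mulr_ge0// sqr_ge0.
have [t1|t1] := leP 1 t.
- apply: (@ger0_derive1_le_cc _ D 1 t); rewrite ?in_itv/= ?lexx ?t1//.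
  + move=> x; rewrite in_itv/= => /andP[x1 _].
    by have [] := dD x (lt_trans ltr01 x1).
  + move=> x; rewrite in_itv/= => /andP[x1 _].
    have := dD x (lt_trans ltr01 x1) => dDx.
    by rewrite derive1E derive_val mulr_ge0// exprn_ge0// subr_ge0 ltW.
  + exact: cD.
- apply: (@ler0_derive1_le_cc _ D t 1); rewrite ?in_itv/= ?lexx ?(ltW t1)//.
  + move=> x; rewrite in_itv/= => /andP[tx _].
    by have [] := dD x (lt_trans t0 tx).
  + move=> x; rewrite in_itv/= => /andP[tx x1].
    have := dD x (lt_trans t0 tx) => dDx.
    rewrite derive1E derive_val mulr_le0_ge0// exprS mulr_le0_ge0 ?sqr_ge0//.
    by rewrite subr_le0 ltW.
  + exact: cD.
Qed.

(** With a^2/6 and a^2/3 in place of 2/3 s^2 and 4/3 s^2, the gap to [ln_ge_pade] is a perfect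
    square over 6 t (t + 2). Trading a^2 for 4 s^2 leaves a bound affine in [a], so its integral
    will involve only the mean of a test function. *)
Lemma ln_ge_tilt (t a s : R) : 0 < t -> a ^+ 2 <= 4 * s ^+ 2 ->
  1 + a - 2 / 3 * s ^+ 2 - (1 + a + 4 / 3 * s ^+ 2) * t^-1 <= ln t.
Proof.
move=> t0 as2; apply: le_trans (ln_ge_pade t0).
have t20 : 0 < t + 2 by rewrite addr_gt0.
have ti : 0 < t^-1 by rewrite invr_gt0.
suff : 0 <= 5 / 2 - 4^-1 * t^-1 - 27 / 4 * (t + 2)^-1
    - (1 + a - a ^+ 2 / 6 - (1 + a + a ^+ 2 / 3) * t^-1) by nra.
rewrite (_ : _ - _ = (a * (t + 2) - 3 * (t - 1)) ^+ 2 / (6 * t * (t + 2))).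
  by rewrite divr_ge0 ?sqr_ge0// !mulr_ge0// ltW.
by field; rewrite !gt_eqF.
Qed.
End pinsker.

(** * Monotonicity of the integral and change of measure *)

Section integral_extra.
Context d (T : measurableType d) (R : realType).
Implicit Types mu nu : {measure set T -> \bar R}.

(* Positive and negative parts integrate to suprema over the simple functions
   below them, so neither measurability nor integrability is needed. *)
Lemma le_integralT mu (f g : T -> \bar R) : (forall x, f x <= g x) ->
  \int[mu]_x f x <= \int[mu]_x g x.
Proof.
move=> fg; rewrite /integral !patch_setT.
have fgT : {in [set: T], forall x, f x <= g x} by [].
apply: leeB; apply: le_ereal_sup => _ [k kf <-]; exists k => // x.
- exact: le_trans (kf x) (funepos_le fgT (in_setT x)).
- exact: le_trans (kf x) (funeneg_le fgT (in_setT x)).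
Qed.

Import HBNNSimple.

(** For a simple function [k] below [B], the defining property of the density on each level set
    turns the integral of [k] under [mu] into that of [k * f] under [nu], which is at most that of
    [B * f]. Then take the supremum over [k]. *)
Lemma integral_density_le mu nu (f B : T -> \bar R) :
  is_density mu nu f -> (forall x, 0 <= B x) ->
  \int[mu]_x B x <= \int[nu]_x (B x * f x).
Proof.
move=> [mf f0 muE] B0; rewrite ge0_integralTE//.
apply: ge_ereal_sup => _ [k kB <-].
apply: (@le_trans _ _ (\int[nu]_x ((k x)%:E * f x))); last first.
  by apply: le_integralT => x; exact: lee_wpmul2r.
(* The values of [k] are nonnegative, so the maximum changes nothing on its range; it makes [F r]
   nonnegative for every real [r], as the exchange of sum and integral requires. *)
pose F (r : R) x := (Num.max r 0 * \1_(k @^-1` [set r]) x)%:E * f x.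
have kE x : (k x)%:E * f x = \sum_(r \in range k) F r x.
  rewrite fimfunE -fsumEFin// ge0_mule_fsuml; last first.
    by move=> r; rewrite EFinM nnfun_muleindic_ge0.
  apply: eq_fsbigr => r; rewrite inE => -[y _ <-].
  by rewrite /F; congr (_%:E * _); congr (_ * _)%R; rewrite max_l.
under [leRHS]eq_integral do rewrite kE.
rewrite ge0_integral_fsum//; first last.
- move=> r x _; rewrite mule_ge0// lee_fin mulr_ge0// ?le_max ?lexx ?orbT//.
- move=> r; apply: emeasurable_funM => //; apply/measurable_EFinP.
  exact: measurable_funM.
rewrite sintegralE; apply: lee_fsum => // r [t _ <-].
rewrite muE// integral_mkcond /F.
rewrite -ge0_integralZl//; first last.
- by rewrite lee_fin.
- by move=> x _; exact: erestrict_ge0.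
- exact/(measurable_restrictT _ _).1/measurable_funTS.
apply: le_integralT => x; rewrite max_l// patchE indicE.
by case: (x \in _); rewrite ?mulr1// ?mulr0 ?mule0 ?mul0e.
Qed.
End integral_extra.

(** * Pinsker's inequality tested on one function with values in [0, 1] *)

Section pinsker_KL.
Context d (T : measurableType d) (R : realType).
Implicit Types mu nu : {measure set T -> \bar R}.

Lemma integrable_unit_valued mu (g : T -> \bar R) : mu setT = 1 ->
  measurable_fun setT g -> (forall x, 0 <= g x <= 1) ->
  mu.-integrable setT g.
Proof.
move=> mu1 mg g01; apply/integrableP; split=> //.
apply: (@le_lt_trans _ _ (\int[mu]_x cst 1 x)).
  by apply: le_integralT => x; have /andP[g0 g1] := g01 x; rewrite gee0_abs.
by rewrite integral_cst// mu1 mule1 ltry.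
Qed.

Lemma integral_prob_cst (mu : probability T R) (c : \bar R) :
  \int[mu]_x c = c.
Proof.
rewrite -[LHS]/(\int[mu]_x cst c x) integral_cst// -[RHS]mule1.
by congr (_ * _); exact: probability_setT.
Qed.

Lemma integral_affine mu (g : T -> R) (a c e : R) : mu setT = 1 ->
  mu.-integrable setT (EFin \o g) -> \int[mu]_x (g x)%:E = a%:E ->
  mu.-integrable setT (fun x => (c + e * g x)%:E) /\
  \int[mu]_x (c + e * g x)%:E = (c + e * a)%:E.
Proof.
move=> mu1 ig ga.
have ic : mu.-integrable setT (EFin \o cst c).
  apply: measurable_bounded_integrable => //; first by rewrite mu1 ltry.
  exists `|c|%R; split; first exact: num_real.
  by move=> M M1 x _ /=; exact: ltW.
have ieg : mu.-integrable setT (fun x => e%:E * (g x)%:E) by exact: integrableZl.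
have E : (fun x => (c + e * g x)%:E) =
         (EFin \o cst c) \+ (fun x => e%:E * (g x)%:E).
  by apply/funext => x; rewrite /= EFinD EFinM.
rewrite E; split; first exact: integrableD.
rewrite integralD// (_ : \int[mu]_x _ = c%:E); last first.
  by rewrite -[LHS]/(\int[mu]_x cst c%:E x) integral_cst// mu1 mule1.
by rewrite integralZl// ga EFinD EFinM.
Qed.

(** Apply [ln_ge_tilt] at t = f x with tilt 4 s g x - 2 s, where s = a - b; the tilt is at most 2
    |s| in size because [g] lies in [0, 1]. This gives A - k / f <= ln f, to be integrated under
    [mu]. *)
Lemma KL_ge_sqr mu nu (g : T -> R) (a b : R) :
  mu setT = 1 -> nu setT = 1 ->
  measurable_fun setT g -> (forall x, 0 <= g x <= 1)%R ->
  \int[mu]_x (g x)%:E = a%:E -> \int[nu]_x (g x)%:E = b%:E ->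
  (2 * (a - b) ^+ 2)%:E <= KL mu nu.
Proof.
move=> mu1 nu1 mg g01 ga gb; rewrite /KL; case: pselect => [H|_]; last exact: leey.
move: (sval (cid H)) (svalP (cid H)) => f fD; have [mf f0 _] := fD.
set s := (a - b)%R.
pose k x : R := (1 - 2 * s + 4 / 3 * s ^+ 2 + 4 * s * g x)%R.
pose A x : R := (1 - 2 * s - 2 / 3 * s ^+ 2 + 4 * s * g x)%R.
(* [B] is [k / f], with value [+oo] where [f = 0] so that [A - B <= lne f] holds
   everywhere; the reciprocal is written with [expR] and [ln] for measurability. *)
pose B x : \bar R := if f x == 0 then +oo else
  if f x == +oo then 0 else (k x * expR (- ln (fine (f x))))%:E.
have k0 x : (0 < k x)%R.
  have /andP[gx0 gx1] := g01 x; rewrite /k.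
  (* Completing the square in [s] leaves 1 - 3/4 (1 - 2 g x)^2, which is at least 1/4. *)
  have : (0 <= (s - 3/4 * (1 - 2 * g x)) ^+ 2)%R by exact: sqr_ge0.
  nra.
have B0 x : 0 <= B x.
  rewrite /B; case: ifPn => // _; case: ifPn => // _.
  by rewrite lee_fin mulr_ge0 ?expR_ge0// ltW.
have mk : measurable_fun setT k.
  by apply: measurable_funD => //; exact: measurable_funM.
have mB : measurable_fun setT B.
  apply: measurable_fun_ifT => //; first exact: measurable_fun_eqe.
  apply: measurable_fun_ifT => //; first exact: measurable_fun_eqe.
  apply/measurable_EFinP/measurable_funM => //.
  apply: measurableT_comp => //; apply: measurableT_comp => //.
  by apply: measurableT_comp => //; apply: measurableT_comp.
have mgE : measurable_fun setT (EFin \o g) by exact/measurable_EFinP.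
have inu := integrable_unit_valued nu1 mgE g01.
have imu := integrable_unit_valued mu1 mgE g01.
have [_ kE] := integral_affine (1 - 2 * s + 4 / 3 * s ^+ 2) (4 * s) nu1 inu gb.
have [iA AE] := integral_affine (1 - 2 * s - 2 / 3 * s ^+ 2) (4 * s) mu1 imu ga.
have fK x : f x != 0 -> f x != +oo -> exists2 t, (0 < t)%R & f x = t%:E.
  move: (f x) (f0 x) => [t|//|//]; rewrite lee_fin => t0 tn0 _.
  by exists t => //; rewrite lt_neqAle t0 andbT eq_sym -eqe.
(* B f equals [k] where [f] is positive and finite, and 0 <= k elsewhere, since 0 times infinity is
   0. Finiteness of this bound then makes [B] integrable. *)
have IB : \int[mu]_x B x <= (1 - 2 * s + 4 / 3 * s ^+ 2 + 4 * s * b)%:E.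
  rewrite -kE; apply: (le_trans (integral_density_le fD B0)).
  apply: le_integralT => x; rewrite -/(k x) /B.
  case: ifPn => [/eqP ->|fx0]; first by rewrite mule0 lee_fin ltW.
  case: ifPn => [/eqP ->|fxy]; first by rewrite mul0e lee_fin ltW.
  have [t t0 ->] := fK _ fx0 fxy.
  by rewrite /= -EFinM expRN lnK ?posrE// mulfVK ?gt_eqF.
have iB : mu.-integrable setT B.
  apply/integrableP; split=> //.
  under eq_integral do rewrite gee0_abs//.
  exact: le_lt_trans IB (ltry _).
apply: (@le_trans _ _ (\int[mu]_x ((A x)%:E - B x))).
  rewrite integralB// AE.
  apply: le_trans (leeB (lexx _) IB).
  (* The two means differ by 4 s (a - b) - 2 s^2 = 2 s^2. *)
  by rewrite -EFinB lee_fin /s; nra.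
apply: le_integralT => x; rewrite /B.
case: ifPn => [_|fx0]; first by rewrite addeNy leNye.
case: ifPn => [/eqP ->|fxy]; first by rewrite leey.
have [t t0 ->] := fK _ fx0 fxy.
rewrite lne_EFin//= -EFinB lee_fin expRN lnK ?posrE//.
have /andP[gx0 gx1] := g01 x.
have as2 : ((4 * s * g x - 2 * s) ^+ 2 <= 4 * s ^+ 2)%R.
  have : (0 <= s ^+ 2)%R by exact: sqr_ge0.
  have : (0 <= g x * (1 - g x))%R by rewrite mulr_ge0// subr_ge0.
  nra.
by have := ln_ge_tilt t0 as2; rewrite /A /k; lra.
Qed.
End pinsker_KL.

(** * Iterated expectations: linearity, Tonelli and exchangeability *)

Section iter_exp_theory.
Context d (T : measurableType d) (R : realType) (P : probability T R).

Lemma iter_exp_ge0 k (F : k.-tuple T -> \bar R) :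
  (forall t, 0 <= F t) -> 0 <= iter_exp P F.
Proof.
elim: k F => [|k IH] F F0 /=; first exact: F0.
by apply: integral_ge0 => z _; exact: IH.
Qed.

Lemma le_iter_exp k (F G : k.-tuple T -> \bar R) :
  (forall t, F t <= G t) -> iter_exp P F <= iter_exp P G.
Proof.
elim: k F G => [|k IH] F G FG /=; first exact: FG.
by apply: le_integralT => z; exact: IH.
Qed.

Lemma eq_iter_exp k (F G : k.-tuple T -> \bar R) :
  (forall t, F t = G t) -> iter_exp P F = iter_exp P G.
Proof. by move=> /funext ->. Qed.

Lemma iter_expS k (F : k.+1.-tuple T -> \bar R) :
  iter_exp P F = \int[P]_z iter_exp P (fun t => F [tuple of z :: t]).
Proof. by []. Qed.

Lemma iter_exp_cst1 k : iter_exp P (fun _ : k.-tuple T => 1) = 1.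
Proof.
elim: k => [//|k IH] /=; under eq_integral do rewrite IH.
exact: integral_prob_cst.
Qed.

Lemma iter_exp_unit k (F : k.-tuple T -> \bar R) :
  (forall t, 0 <= F t <= 1) -> 0 <= iter_exp P F <= 1.
Proof.
move=> F01; rewrite iter_exp_ge0/=; last by move=> t; case/andP: (F01 t).
by rewrite -(iter_exp_cst1 k); apply: le_iter_exp => t; case/andP: (F01 t).
Qed.

Lemma measurable_tcons k d' (S : measurableType d') (f : S -> T)
    (g : S -> k.-tuple T) : measurable_fun setT f -> measurable_fun setT g ->
  measurable_fun setT (fun s => [tuple of f s :: g s]).
Proof. exact: measurable_cons. Qed.

(** The parameter space [S] varies in the induction: the head of the tuple joins the parameter,
    giving [S * T], and is integrated out last by Tonelli. *)
Lemma measurable_iter_exp k d' (S : measurableType d')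
    (F : S * k.-tuple T -> \bar R) :
  measurable_fun setT F -> (forall x, 0 <= F x) ->
  measurable_fun setT (fun s => iter_exp P (fun t => F (s, t))).
Proof.
elim: k d' S F => [|k IH] d' S F mF F0 /=.
  exact: (measurableT_comp mF (measurable_fun_pair _ _)).
pose G (p : S * T) := iter_exp P (fun t => F (p.1, [tuple of p.2 :: t])).
have mG : measurable_fun setT G.
  apply: (IH _ _ (fun q : (S * T) * k.-tuple T => F (q.1.1, [tuple of q.1.2 :: q.2]))) => //.
  apply: (measurableT_comp mF); apply: measurable_fun_pair.
    exact: (measurableT_comp measurable_fst measurable_fst).
  apply: measurable_tcons; last exact: measurable_snd.
  exact: (measurableT_comp measurable_snd measurable_fst).
have G0 p : 0 <= G p by exact: iter_exp_ge0.
exact: (measurable_fun_fubini_tonelli_F (m2 := P) G mG G0).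
Qed.

Lemma measurable_slice k (F : k.+1.-tuple T -> \bar R) z :
  measurable_fun setT F -> measurable_fun setT (fun t : k.-tuple T => F [tuple of z :: t]).
Proof.
move=> mF; apply: (measurableT_comp mF); exact: measurable_tcons.
Qed.

Lemma measurable_iter_slice k (F : k.+1.-tuple T -> \bar R) :
  measurable_fun setT F -> (forall x, 0 <= F x) ->
  measurable_fun setT (fun z => iter_exp P (fun t : k.-tuple T => F [tuple of z :: t])).
Proof.
move=> mF F0.
apply: (measurable_iter_exp (F := fun q : T * k.-tuple T => F [tuple of q.1 :: q.2])) => //.
apply: (measurableT_comp mF); exact: measurable_tcons.
Qed.

Lemma iter_expD k (F G : k.-tuple T -> \bar R) :
  measurable_fun setT F -> (forall x, 0 <= F x) ->
  measurable_fun setT G -> (forall x, 0 <= G x) ->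
  iter_exp P (fun t => F t + G t) = iter_exp P F + iter_exp P G.
Proof.
elim: k F G => [//|k IH] F G mF F0 mG G0 /=.
rewrite -ge0_integralD//.
- apply: eq_integral => z _; apply: IH => //; exact: measurable_slice.
- by move=> z _; exact: iter_exp_ge0.
- exact: measurable_iter_slice.
- by move=> z _; exact: iter_exp_ge0.
- exact: measurable_iter_slice.
Qed.

Lemma iter_expZl k (c : \bar R) (F : k.-tuple T -> \bar R) : 0 <= c ->
  measurable_fun setT F -> (forall x, 0 <= F x) ->
  iter_exp P (fun t => c * F t) = c * iter_exp P F.
Proof.
move=> c0; elim: k F => [//|k IH] F mF F0 /=.
rewrite -ge0_integralZl//.
- apply: eq_integral => z _; apply: IH => //; exact: measurable_slice.
- exact: measurable_iter_slice.
- by move=> z _; exact: iter_exp_ge0.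
Qed.

Lemma iter_exp_sum k n (F : 'I_n -> k.-tuple T -> \bar R) :
  (forall i, measurable_fun setT (F i)) -> (forall i x, 0 <= F i x) ->
  iter_exp P (fun t => \sum_(i < n) F i t) = \sum_(i < n) iter_exp P (F i).
Proof.
elim: n F => [|n IH] F mF F0.
  under eq_iter_exp do rewrite big_ord0; rewrite big_ord0.
  elim: k {F mF F0} => [//|k IH] /=; under eq_integral do rewrite IH.
  exact: integral0.
under eq_iter_exp do rewrite big_ord_recl.
rewrite iter_expD//; first by rewrite big_ord_recl IH.
- exact: emeasurable_sum.
- by move=> x; apply: sume_ge0.
Qed.

(** The bounds by 1 pass to the inner expectations and make them integrable, so that each integral
    may be split over the difference. *)
Lemma iter_expB k (F G : k.-tuple T -> \bar R) :
  measurable_fun setT F -> (forall x, 0 <= F x <= 1) ->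
  measurable_fun setT G -> (forall x, 0 <= G x <= 1) ->
  iter_exp P (fun t => F t - G t) = iter_exp P F - iter_exp P G.
Proof.
elim: k F G => [//|k IH] F G mF F01 mG G01 /=.
have unit_ge0 (H : k.+1.-tuple T -> \bar R) :
  (forall x, 0 <= H x <= 1) -> forall x, 0 <= H x.
  by move=> H01 x; case/andP: (H01 x).
rewrite -integralB//.
- apply: eq_integral => z _; apply: IH => //; exact: measurable_slice.
- apply: integrable_unit_valued; first exact: probability_setT.
  + by apply: measurable_iter_slice => //; exact: unit_ge0.
  + by move=> z; exact: iter_exp_unit.
- apply: integrable_unit_valued; first exact: probability_setT.
  + by apply: measurable_iter_slice => //; exact: unit_ge0.
  + by move=> z; exact: iter_exp_unit.
Qed.

Lemma iter_exp_swap k (F : k.-tuple T * T -> \bar R) :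
  measurable_fun setT F -> (forall x, 0 <= F x) ->
  \int[P]_z iter_exp P (fun t => F (t, z)) =
  iter_exp P (fun t => \int[P]_z F (t, z)).
Proof.
elim: k F => [//|k IH] F mF F0 /=.
pose G (p : T * T) := iter_exp P (fun t => F ([tuple of p.2 :: t], p.1)).
have mG : measurable_fun setT G.
  apply: (measurable_iter_exp (F := fun q : (T * T) * k.-tuple T =>
    F ([tuple of q.1.2 :: q.2], q.1.1))) => //.
  apply: (measurableT_comp mF); apply: measurable_fun_pair.
    apply: measurable_tcons; last exact: measurable_snd.
    exact: (measurableT_comp measurable_snd measurable_fst).
  exact: (measurableT_comp measurable_fst measurable_fst).
(* Exchange the extra point with the head of the tuple, then recurse on the tail. *)
rewrite (fubini_tonelli (m1 := P) (m2 := P) G mG); last by move=> p; exact: iter_exp_ge0.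
apply: eq_integral => z0 _.
apply: (IH (fun q => F ([tuple of z0 :: q.1], q.2))) => //.
apply: (measurableT_comp mF); apply: measurable_fun_pair; last exact: measurable_snd.
apply: measurable_tcons => //; exact: measurable_fst.
Qed.

(** This is the exchangeability of the sample: a left-out point has the law of a fresh one. If the
    head is left out, it is moved innermost by [iter_exp_swap]; otherwise it stays the head of the
    reduced sample and the induction runs on the tail. *)
Lemma iter_exp_pick m (u : 'I_m.+1) (F : m.-tuple T * T -> \bar R) :
  measurable_fun setT F -> (forall x, 0 <= F x) ->
  iter_exp P (fun z : m.+1.-tuple T =>
    F ([tuple tnth z (lift u j) | j < m], tnth z u)) =
  iter_exp P (fun t => \int[P]_z F (t, z)).
Proof.
elim: m u F => [|m IH] u F mF F0.
  rewrite (ord1 u) -iter_exp_swap//=; apply: eq_integral => z _.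
  by congr (F (_, _)); rewrite [LHS]tuple0 [RHS]tuple0.
have [u'|] := unliftP ord0 u; last first.
  move=> ->; rewrite -iter_exp_swap// iter_expS; apply: eq_integral => z _.
  apply: eq_iter_exp => t; congr (F (_, _)).
  by apply: eq_from_tnth => i; rewrite tnth_mktuple tnthS.
move=> ->; rewrite iter_expS [RHS]iter_expS; apply: eq_integral => z _.
rewrite -(IH u' (fun q => F ([tuple of z :: q.1], q.2)))//; last first.
  apply: (measurableT_comp mF); apply: measurable_fun_pair; last exact: measurable_snd.
  by apply: measurable_tcons => //; exact: measurable_fst.
apply: eq_iter_exp => t; congr (F (_, _)); last by rewrite tnthS.
apply: eq_from_tnth => i; rewrite tnth_mktuple.
have [j ->|->] := unliftP ord0 i.
  rewrite tnthS tnth_mktuple (_ : lift _ _ = lift ord0 (lift u' j)) ?tnthS//.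
  by apply/val_inj; rewrite /= /bump !add1n ltnS addnS.
by rewrite (_ : lift _ _ = ord0)//; exact/val_inj.
Qed.
End iter_exp_theory.

(** * Averages over the left-out index *)

Lemma average_unit (R : realType) k (F : 'I_k -> \bar R) : (0 < k)%N ->
  (forall i, 0 <= F i <= 1) -> 0 <= (k%:R^-1)%:E * \sum_(i < k) F i <= 1.
Proof.
move=> k0 F01; apply/andP; split.
  apply: mule_ge0; first by rewrite lee_fin invr_ge0.
  by apply: sume_ge0 => i _; case/andP: (F01 i).
rewrite lee_pdivrMl ?ltr0n// mule1.
apply: (@le_trans _ _ (\sum_(i < k) 1%:E)).
  by apply: lee_sum => i _; case/andP: (F01 i).
by rewrite sumEFin sumr_const card_ord.
Qed.

Section average_measure.
Context d (T : measurableType d) (R : realType) (n : nat).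
Variable m : 'I_n.+1 -> {measure set T -> \bar R}.
Hypothesis m1 : forall u, m u setT = 1.

(** Building the mixture from [mscale] and [msum] provides the measure structure that [KL_ge_sqr]
    asks for. [msum] is indexed by natural numbers, hence [inord]. *)
Let nu : {measure set T -> \bar R} :=
  mscale ((n.+1%:R^-1)%:nng)%R (msum (fun k => m (inord k)) n.+1).

Let nuE : nu = (fun A => (n.+1%:R^-1)%:E * \sum_(u < n.+1) m u A)
  :> (set T -> \bar R).
Proof.
apply/funext => A; rewrite /nu/= /mscale/= /msum/=; congr (_ * _).
by apply: eq_bigr => u _; rewrite inord_val.
Qed.

Let nu1 : nu setT = 1.
Proof.
rewrite nuE; under eq_bigr do rewrite m1.
by rewrite sumEFin sumr_const card_ord -EFinM mulVf.
Qed.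

Lemma average_KL_ge (g : 'I_n.+1 -> T -> R) (l : 'I_n.+1 -> 'I_n.+1 -> R) :
  (forall u, measurable_fun setT (g u)) -> (forall u x, 0 <= g u x <= 1)%R ->
  (forall v u, \int[m v]_x (g u x)%:E = (l v u)%:E) ->
  (2 * (n.+1%:R^-1 *
     \sum_(u < n.+1) (l u u - n.+1%:R^-1 * \sum_(v < n.+1) l v u)) ^+ 2)%:E <=
  (n.+1%:R^-1)%:E * \sum_(u < n.+1)
    KL (m u) (fun A => (n.+1%:R^-1)%:E * \sum_(v < n.+1) m v A).
Proof.
move=> mg g01 lE; rewrite -nuE.
pose b u : R := (n.+1%:R^-1 * \sum_(v < n.+1) l v u)%R.
have bE u : \int[nu]_x (g u x)%:E = (b u)%:E.
  rewrite /nu ge0_integral_mscale//; first last.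
  - by move=> x _; rewrite lee_fin; case/andP: (g01 u x).
  - exact/measurable_EFinP.
  rewrite ge0_integral_measure_sum//; first last.
  - exact/measurable_EFinP.
  - by move=> x _; rewrite lee_fin; case/andP: (g01 u x).
  by under eq_bigr do rewrite inord_val lE; rewrite sumEFin.

pose D u : R := (l u u - b u)%R; pose e : R := (n.+1%:R^-1 * \sum_(u < n.+1) D u)%R.
apply: (@le_trans _ _ ((n.+1%:R^-1)%:E * \sum_(u < n.+1) (2 * D u ^+ 2)%:E)).
  rewrite sumEFin -EFinM lee_fin -/e.
  rewrite ler_pdivlMl//.
  (* Jensen for the square by its tangent at the mean [e]: D^2 >= 2 e D - e^2, with equality of the
     sums because the [D u] add up to (n + 1) e. *)
  have -> : (n.+1%:R * (2 * e ^+ 2) =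
             \sum_(u < n.+1) (4 * e * D u - 2 * e ^+ 2))%R.
    rewrite sumrB sumr_const card_ord -mulr_sumr -[in RHS]mulr_natl.
    have -> : (\sum_(u < n.+1) D u = n.+1%:R * e)%R by rewrite /e mulVKf.
    ring.
  by apply: ler_sum => u _; have := sqr_ge0 (D u - e); nra.
apply: lee_wpmul2l; first by rewrite lee_fin invr_ge0.
by apply: lee_sum => u _; exact: (KL_ge_sqr (g := g u)).
Qed.
End average_measure.

(** The factor n / (n - 1) arises here. With S the sum of all entries and T the trace, both sides
    are (S - (k + 1) T) / (k (k + 1)), since [lift u] enumerates the indices other than [u]. *)
Lemma loo_average_diff (R : realFieldType) k (l : 'I_k.+1 -> 'I_k.+1 -> R) :
  (0 < k)%N ->
  (k.+1%:R^-1 * \sum_(u < k.+1) (k%:R^-1 * \sum_(j < k) l u (lift u j))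
    - k.+1%:R^-1 * \sum_(u < k.+1) l u u =
  - (k.+1%:R / k%:R) * (k.+1%:R^-1 * \sum_(u < k.+1)
      (l u u - k.+1%:R^-1 * \sum_(v < k.+1) l v u)))%R.
Proof.
move=> k0; have kn0 : (k%:R != 0 :> R)%R by rewrite pnatr_eq0 -lt0n.
have sn0 : (1 + k%:R != 0 :> R)%R by rewrite addrC natr1 pnatr_eq0.
have loo u : (\sum_(j < k) l u (lift u j) = \sum_(i < k.+1) l u i - l u u)%R.
  by rewrite (bigD1_ord u)//= addrAC subrr add0r.
under eq_bigr do rewrite loo.
rewrite -mulr_sumr !sumrB -mulr_sumr (exchange_big_dep predT)//= -natr1.
by field; rewrite kn0 andbT addrC.
Qed.

(** * From the generalization gap to leave-one-out averages *)

Section generalization.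
Context (R : realType) dX dY dR dO (X : measurableType dX)
  (Y : measurableType dY) (Rs : measurableType dR) (Om : measurableType dO).
Context (k : nat) (P : probability (X * Y)%type R) (Q : probability Om R)
  (h : Om -> k.-tuple (X * Y)%type -> X -> Rs) (ell : Rs -> Y -> R).
Hypothesis k0 : (0 < k)%N.
Hypothesis mh : measurable_fun [set: Om * (k.-tuple (X * Y)%type * X)]
  (fun p => h p.1 p.2.1 p.2.2).
Hypothesis mell : measurable_fun [set: Rs * Y] (fun p => ell p.1 p.2).
Hypothesis ell01 : forall r y, (0 <= ell r y <= 1)%R.

Local Notation Z := (X * Y)%type.

(** Training set and test point are paired first, so that integrating out the randomness leaves a
    function of the shape taken by [iter_exp_pick]. *)
Let loss (q : (k.-tuple Z * Z) * Om) : \bar R :=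
  (ell (h q.2 q.1.1 q.1.2.1) q.1.2.2)%:E.

Let mean_loss (q : k.-tuple Z * Z) : \bar R := \int[Q]_w loss (q, w).

Let mean_emp (t : k.-tuple Z) : \bar R :=
  (k%:R^-1)%:E * \sum_(j < k) mean_loss (t, tnth t j).

Let mean_true (t : k.-tuple Z) : \bar R := \int[P]_zz mean_loss (t, zz).

Let loss01 q : 0 <= loss q <= 1. Proof. by rewrite !lee_fin. Qed.

Let loss_ge0 q : 0 <= loss q. Proof. by case/andP: (loss01 q). Qed.

Let measurable_loss : measurable_fun setT loss.
Proof.
apply/measurable_EFinP.
apply: (measurableT_comp mell (g := fun q : (k.-tuple Z * Z) * Om =>
  (h q.2 q.1.1 q.1.2.1, q.1.2.2))).
apply: measurable_fun_pair.
  apply: (measurableT_comp mh (g := fun q : (k.-tuple Z * Z) * Om =>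
    (q.2, (q.1.1, q.1.2.1)))).
  apply: measurable_fun_pair => //; apply: measurable_fun_pair.
    by apply: (measurableT_comp measurable_fst).
  apply: (measurableT_comp measurable_fst).
  by apply: (measurableT_comp measurable_snd).
apply: (measurableT_comp measurable_snd).
by apply: (measurableT_comp measurable_snd).
Qed.

Let mean_unit d (T : measurableType d) (mu : probability T R) (f : T -> \bar R) :
  (forall x, 0 <= f x <= 1) -> 0 <= \int[mu]_x f x <= 1.
Proof.
move=> f01; rewrite integral_ge0/=; last by move=> x _; case/andP: (f01 x).
rewrite -[leRHS](integral_prob_cst mu 1).
by apply: le_integralT => x; case/andP: (f01 x).
Qed.

Let mean_loss01 q : 0 <= mean_loss q <= 1.
Proof. exact: mean_unit. Qed.

Let mean_loss_ge0 q : 0 <= mean_loss q.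
Proof. by case/andP: (mean_loss01 q). Qed.

Let mean_emp01 t : 0 <= mean_emp t <= 1.
Proof. exact: average_unit. Qed.

Let mean_emp_ge0 t : 0 <= mean_emp t.
Proof. by case/andP: (mean_emp01 t). Qed.

Let mean_true01 t : 0 <= mean_true t <= 1.
Proof. exact: mean_unit. Qed.

Let measurable_mean_loss : measurable_fun setT mean_loss.
Proof.
exact: (measurable_fun_fubini_tonelli_F (m2 := Q) loss measurable_loss loss_ge0).
Qed.

Let measurable_mean_emp : measurable_fun setT mean_emp.
Proof.
apply: emeasurable_funM => //; apply: emeasurable_sum => j.
apply: (measurableT_comp measurable_mean_loss); apply: measurable_fun_pair => //.
exact: measurable_tnth.
Qed.

Let measurable_mean_true : measurable_fun setT mean_true.
Proof.
exact: (measurable_fun_fubini_tonelli_F (m2 := P) mean_loss measurable_mean_loss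
  mean_loss_ge0).
Qed.

(** The randomness is integrated first: through a finite sum for the empirical loss, by Tonelli for
    the true loss. *)
Let gen_mean : gen (n := k.+1) P Q h ell =
  `| iter_exp P mean_emp - iter_exp P mean_true |.
Proof.
rewrite /gen -iter_expB//; congr abse; apply: eq_iter_exp => t.
have mlw zz : measurable_fun setT (fun w => loss ((t, zz), w)).
  by apply: (measurableT_comp measurable_loss); exact: measurable_fun_pair.
have mzw : measurable_fun setT (fun q : Z * Om => loss ((t, q.1), q.2)).
  apply: (measurableT_comp measurable_loss); apply: measurable_fun_pair => //.
  exact: measurable_fun_pair.
have mwz : measurable_fun setT (fun q : Om * Z => loss ((t, q.2), q.1)).
  apply: (measurableT_comp measurable_loss); apply: measurable_fun_pair => //.
  exact: measurable_fun_pair.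
have empE : \int[Q]_w emp_loss (n := k.+1) h ell w t = mean_emp t.
  have mj (j : 'I_k) : measurable_fun setT
      (fun w => (ell (h w t (tnth t j).1) (tnth t j).2)%:E) by exact: mlw.
  have j0 (j : 'I_k) w : 0 <= (ell (h w t (tnth t j).1) (tnth t j).2)%:E.
    exact: (loss_ge0 ((t, tnth t j), w)).
  rewrite ge0_integralZl ?lee_fin//; first last.
  - by move=> w _; exact: sume_ge0.
  - exact: emeasurable_sum.
  by congr (_ * _); rewrite ge0_integral_sum.
have trueE : \int[Q]_w true_loss (n := k.+1) P h ell w t = mean_true t.
  exact/esym/(fubini_tonelli (m1 := P) (m2 := Q) _ mzw).
rewrite -empE -trueE integralB//.
- apply: integrable_unit_valued; first exact: probability_setT.
  + by apply: emeasurable_funM => //; apply: emeasurable_sum => j; exact: mlw.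
  + by move=> w; apply: average_unit => // j; rewrite !lee_fin.
- apply: integrable_unit_valued; first exact: probability_setT.
  + exact: (measurable_fun_fubini_tonelli_F (m2 := P) _ mwz).
  + by move=> w; apply: mean_unit => zz; rewrite !lee_fin.
Qed.

(** [avg_emp] and [avg_true] carry both losses over to the larger sample on which the CMI is
    defined; in [avg_true] the left-out point serves as test point. *)
Let avg_emp (z : k.+1.-tuple Z) : \bar R :=
  (k.+1%:R^-1)%:E * \sum_(u < k.+1) mean_emp (loo_set (n := k.+1) z u).

Let avg_true (z : k.+1.-tuple Z) : \bar R :=
  (k.+1%:R^-1)%:E *
  \sum_(u < k.+1) mean_loss (loo_set (n := k.+1) z u, tnth z u).

Let measurable_loo_set u :
  measurable_fun setT (fun z : k.+1.-tuple Z => loo_set (n := k.+1) z u).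
Proof.
apply/measurable_fun_tnthP => j /=.
rewrite (_ : _ \o _ = fun z : k.+1.-tuple Z => tnth z (lift u j)).
  exact: measurable_tnth.
by apply/funext => z /=; rewrite tnth_mktuple.
Qed.

Let iter_exp_average (F : 'I_k.+1 -> k.+1.-tuple Z -> \bar R) (c : \bar R) :
  (forall u, measurable_fun setT (F u)) -> (forall u z, 0 <= F u z) ->
  (forall u, iter_exp P (F u) = c) ->
  iter_exp P (fun z => (k.+1%:R^-1)%:E * \sum_(u < k.+1) F u z) = c.
Proof.
move=> mF F0 Fc; rewrite iter_expZl ?lee_fin//; first last.
- by move=> z; exact: sume_ge0.
- exact: emeasurable_sum.
rewrite iter_exp_sum// (eq_bigr (fun=> 1%:E * c)); last first.
  by move=> u _; rewrite Fc mul1e.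
rewrite -ge0_sume_distrl// sumEFin sumr_const card_ord muleA -EFinM.
by rewrite mulVf// mul1e.
Qed.

Let measurable_emp_loo u :
  measurable_fun setT (fun z => mean_emp (loo_set (n := k.+1) z u)).
Proof. exact: (measurableT_comp measurable_mean_emp). Qed.

Let measurable_loss_loo u : measurable_fun setT (fun z : k.+1.-tuple Z =>
  mean_loss (loo_set (n := k.+1) z u, tnth z u)).
Proof.
apply: (measurableT_comp measurable_mean_loss); apply: measurable_fun_pair => //.
exact: measurable_tnth.
Qed.

Let iter_exp_avg_emp : iter_exp P avg_emp = iter_exp P mean_emp.
Proof.
apply: iter_exp_average => // u.
rewrite (iter_exp_pick P u (F := fun q => mean_emp q.1))//=; last first.
  exact: (measurableT_comp measurable_mean_emp measurable_fst).
by apply: eq_iter_exp => t; exact: integral_prob_cst.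
Qed.

Let iter_exp_avg_true : iter_exp P avg_true = iter_exp P mean_true.
Proof.
by apply: iter_exp_average => // u; exact: (iter_exp_pick P u (F := mean_loss)).
Qed.

Let measurable_avg_emp : measurable_fun setT avg_emp.
Proof. by apply: emeasurable_funM => //; exact: emeasurable_sum. Qed.

Let measurable_avg_true : measurable_fun setT avg_true.
Proof. by apply: emeasurable_funM => //; exact: emeasurable_sum. Qed.

Let measurable_pred_vec z u :
  measurable_fun setT (pred_vec (n := k.+1) h z u).
Proof.
apply/measurable_fun_tnthP => i /=.
rewrite (_ : _ \o _ = fun w => h w (loo_set (n := k.+1) z u) (tnth z i).1).
  apply: (measurableT_comp mh (g := fun w =>
    (w, (loo_set (n := k.+1) z u, (tnth z i).1)))).
  exact: measurable_fun_pair.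
by apply/funext => w /=; rewrite tnth_mktuple.
Qed.

Let avg_gap (z : k.+1.-tuple Z) :
  `| avg_emp z - avg_true z | <=
  (k.+1%:R / k%:R / Num.sqrt 2)%:E * poweR (floo_CMI (n := k.+1) Q h z) 2^-1.
Proof.
pose l v u : R := fine (mean_loss (loo_set (n := k.+1) z v, tnth z u)).
have lE v u : mean_loss (loo_set (n := k.+1) z v, tnth z u) = (l v u)%:E.
  rewrite fineK// ge0_fin_numE//.
  by case/andP: (mean_loss01 (loo_set (n := k.+1) z v, tnth z u)) => _ /le_lt_trans; apply; rewrite ltry.
pose e : R := (k.+1%:R^-1 * \sum_(u < k.+1)
  (l u u - k.+1%:R^-1 * \sum_(v < k.+1) l v u))%R.
have -> : avg_emp z - avg_true z = (- (k.+1%:R / k%:R) * e)%:E.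
  rewrite -loo_average_diff// EFinB; congr (_ - _).
    rewrite EFinM -sumEFin; congr (_ * _); apply: eq_bigr => u _.
    rewrite EFinM -sumEFin; congr (_ * _); apply: eq_bigr => j _.
    by rewrite -lE tnth_mktuple.
  by rewrite EFinM -sumEFin; congr (_ * _); apply: eq_bigr => u _; rewrite lE.
(* This is [cond_law] with its measure structure. *)
pose m u := measure_function_pushforward__canonical__measure_function_Measure
  Q (measurable_pred_vec z u).
have m1 u : m u setT = 1.
  by rewrite /m/= /pushforward preimage_setT; exact: probability_setT.
(* As [z] is fixed, its label is a constant, and the loss at point [u] is a function of the
   prediction vector alone. *)
pose g u (r : k.+1.-tuple Rs) : R := ell (tnth r u) (tnth z u).2.
have mg u : measurable_fun setT (g u).
  apply: (measurableT_comp mell (g := fun r : k.+1.-tuple Rs =>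
    (tnth r u, (tnth z u).2))).
  apply: measurable_fun_pair => //; exact: measurable_tnth.
have gE v u : \int[m v]_x (g u x)%:E = (l v u)%:E.
  rewrite -lE ge0_integral_pushforward//.
  - rewrite preimage_setT; apply: eq_integral => w _ /=.
    by rewrite /loss /g tnth_mktuple.
  - exact/measurable_EFinP.
  - by move=> r _; rewrite lee_fin; case/andP: (ell01 (tnth r u) (tnth z u).2).
have kl : (2 * e ^+ 2)%:E <= floo_CMI (n := k.+1) Q h z.
  exact: (average_KL_ge m1 mg (fun u x => ell01 _ _) gE).
have s20 : (0 < Num.sqrt 2 :> R)%R by rewrite sqrtr_gt0.
have kl' : (Num.sqrt 2 * `|e|)%:E <= poweR (floo_CMI (n := k.+1) Q h z) 2^-1.
  move: kl; case: (floo_CMI _ _ _) => [r|_|//].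
    rewrite lee_fin => er; rewrite poweR_EFin lee_fin powR12_sqrt; last first.
      by apply: le_trans er; rewrite mulr_ge0// sqr_ge0.
    by rewrite -sqrtr_sqr -sqrtrM// ler_sqrt// (le_trans _ er)// mulr_ge0// sqr_ge0.
  (* An infinite CMI has an infinite square root. *)
  by rewrite poweRyr ?leey// invr_eq0.
have c0 : (0 <= k.+1%:R / k%:R :> R)%R by rewrite divr_ge0.
apply: (@le_trans _ _ ((k.+1%:R / k%:R / Num.sqrt 2)%:E * (Num.sqrt 2 * `|e|)%:E)).
  rewrite abse_EFin -EFinM lee_fin normrM normrN (ger0_norm c0).
  by rewrite mulrA divfK// gt_eqF.
by apply: lee_wpmul2l => //; rewrite lee_fin divr_ge0// ltW.
Qed.

Lemma gen_le_floo_CMI : gen (n := k.+1) P Q h ell <=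
  (k.+1%:R / k%:R / Num.sqrt 2)%:E *
    iter_exp P (fun z => poweR (floo_CMI (n := k.+1) Q h z) 2^-1).
Proof.
rewrite gen_mean -iter_exp_avg_emp -iter_exp_avg_true.
have unit_fin (x : \bar R) : 0 <= x <= 1 -> x \is a fin_num.
  move=> /andP[x0 x1]; rewrite ge0_fin_numE//.
  by apply: le_lt_trans x1 _; rewrite ltry.
have emp01 z : 0 <= avg_emp z <= 1 by exact: average_unit.
have true01 z : 0 <= avg_true z <= 1 by exact: average_unit.
pose D z := `| avg_emp z - avg_true z |.
have D0 z : 0 <= D z by exact: abse_ge0.
have mD : measurable_fun setT D.
  apply: (measurableT_comp (f := abse)); first exact: abse_measurable.
  exact: emeasurable_funB.
(* The bound of |E emp - E true| by E |emp - true| is obtained as two inequalities between sums of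
   nonnegative functions, the form that [iter_expD] handles. *)
have empD : iter_exp P avg_emp <= iter_exp P avg_true + iter_exp P D.
  rewrite -iter_expD//; last by move=> z; case/andP: (true01 z).
  apply: le_iter_exp => z; rewrite addeC -leeBlDr ?unit_fin//.
  exact: lee_abs.
have trueD : iter_exp P avg_true <= iter_exp P avg_emp + iter_exp P D.
  rewrite -iter_expD//; last by move=> z; case/andP: (emp01 z).
  apply: le_iter_exp => z; rewrite addeC -leeBlDr ?unit_fin//.
  rewrite /D -abseN fin_num_oppeB ?unit_fin// [in leRHS]addeC.
  exact: lee_abs.
apply: (@le_trans _ _ (iter_exp P D)).
  have fe := unit_fin _ (iter_exp_unit P emp01).
  have ft := unit_fin _ (iter_exp_unit P true01).
  move: (iter_exp_ge0 P D0) empD trueD fe ft.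
  case: (iter_exp P avg_emp) => // a; case: (iter_exp P avg_true) => // b.
  case: (iter_exp P D) => [c|*|//]; last by rewrite leey.
  rewrite -EFinB -!EFinD !lee_fin => _ ? ? _ _.
  by rewrite ler_norml; lra.
have K0 : (0 < k.+1%:R / k%:R / Num.sqrt 2 :> R)%R.
  by rewrite divr_gt0 ?sqrtr_gt0// divr_gt0 ?ltr0n.
(* The constant is moved to the side of [D], whose measurability is known, before it enters the
   expectation. *)
rewrite -lee_pdivrMl// -iter_expZl ?lee_fin ?invr_ge0 ?(ltW K0)//.
by apply: le_iter_exp => z; rewrite lee_pdivrMl//; exact: avg_gap.
Qed.
End generalization.

Unset Implicit Arguments.

Theorem theorem2 (R : realType) (dX dY dR dO : measure_display)
  (X : measurableType dX) (Y : measurableType dY)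
  (Rs : measurableType dR) (Om : measurableType dO)
  (n : nat) (P : probability (X * Y)%type R) (Q : probability Om R)
  (h : Om -> (n.-1).-tuple (X * Y)%type -> X -> Rs) (ell : Rs -> Y -> R) :
  (2 <= n)%N ->
  measurable_fun [set: Om * ((n.-1).-tuple (X * Y)%type * X)]
    (fun p => h p.1 p.2.1 p.2.2) ->
  measurable_fun [set: Rs * Y] (fun p => ell p.1 p.2) ->
  (forall r y, (0 <= ell r y <= 1)%R) ->
  gen P Q h ell <=
    ((n%:R / (n.-1)%:R) / Num.sqrt 2)%:E *
      iter_exp P (fun z => poweR (floo_CMI Q h z) 2^-1).
Proof.
case: n h => [//|k] h n2 mh mell ell01.
exact: gen_le_floo_CMI.
Qed.
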